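(* Let $(X,\rho)$ be a nonempty complete metric space, let $k\in(0,1)$, and let $T:X\to X$ be a mapping. Then the following two statements are equivalent: (1) $T$ is a universal iterative contraction map on $X$ with constant $k$. (2) There exists $\alpha\in X$ which is the unique fixed point of $T$ in $X$, and for every $x\in X$ one has $\lim_{n\to\infty}T^nx=\alpha$.
   Context: $\mathbb{N}$ denotes the set of positive integers, and $T^n$ denotes the $n$-fold composition of $T$ with itself. Definition. Let $(X,\rho)$ be a metric space, $T:X\to X$ a mapping and $k\in[0,1)$. $T$ is called a universal iterative contraction map with constant $k$ if both of the following hold: - for any distinct points $x,y\in X$ there exists $N_y^x\in\mathbb{N}$ such that $\rho(T^{N_y^x}x,T^{N_y^x}y)\leq k\,\rho(x,y)$; - for each $x\in X$ there exists $N_x^x\in\mathbb{N}$ such that $\rho(T^{N_x^x}x,T^{N_x^x+n}x)\leq k\,\rho(x,T^nx)$ for every $n\in\mathbb{N}$. No continuity of $T$ is assumed. *)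

(* Defs.v *)
From HB Require Import structures.
From mathcomp Require Import all_boot all_order all_algebra.
From mathcomp Require Import all_classical all_reals topology.

Set Implicit Arguments.
Unset Strict Implicit.
Unset Printing Implicit Defensive.

Import Order.TTheory GRing.Theory Num.Theory.

Local Open Scope classical_set_scope.
Local Open Scope ring_scope.

(* The library has complete uniform spaces and metric spaces, but not their
   join. [Complete] includes a base point: these are the nonempty complete
   metric spaces. *)
#[short(type="completeMetricType")]
HB.structure Definition CompleteMetric (R : numDomainType) :=
  {X of Complete X & Metric R X}.

(* The iteration counts N and n range over the positive integers. *)
Definition universal_iterative_contraction (R : realType) (X : metricType R)
    (k : R) (T : X -> X) : Prop :=
  [/\ 0 <= k < 1,
      forall x y : X, x <> y ->
        exists N : nat, (0 < N)%N /\
          mdist (iter N T x) (iter N T y) <= k * mdist x y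
    & forall x : X,
        exists N : nat, (0 < N)%N /\
          forall n : nat, (0 < n)%N ->
            mdist (iter N T x) (iter (N + n) T x) <= k * mdist x (iter n T x)].

(* Main.v *)
Require Import Defs.
From HB Require Import structures.
From mathcomp Require Import all_boot all_order all_algebra.
From mathcomp Require Import all_classical all_reals topology.
From mathcomp Require Import normedtype sequences ring lra.

Set Implicit Arguments.
Unset Strict Implicit.
Unset Printing Implicit Defensive.

Import Order.TTheory GRing.Theory Num.Theory.
Import numFieldNormedType.Exports.

Local Open Scope classical_set_scope.
Local Open Scope ring_scope.

(** Why the theorem is true.

    From the contraction conditions to the fixed point: the second condition
    bounds each orbit, because [d(x, T^(N+n) x) <= d(x, T^N x) + k d(x, T^n x)]
    lets the values [n <= N] control all the others
    ([contraction_orbit_bounded]).  Applied again and again along the orbit, it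
    finds for each [j] a point of the orbit from which the whole remaining
    orbit lies within [k^j M] ([contraction_orbit_shrinks]); so orbits are
    Cauchy and converge.  The first condition, also iterated, brings two orbits
    arbitrarily close at arbitrarily late common times
    ([contraction_orbits_approach]), so all orbits have the same limit
    [alpha].  As [T] need not be continuous, [T alpha = alpha] takes an
    argument of its own: the second condition at [alpha] and the convergence of
    [T^n alpha] to [alpha] force [T^N alpha = alpha] for some [N > 0], and
    then the orbit of [alpha], being both periodic and convergent, is constant
    ([contraction_limit_fixed]).

    From the fixed point to the contraction conditions: distances between
    points of the orbits tend to 0, so all that is needed is a positive lower
    bound for the right-hand sides.  For the second condition this is
    [inf_n d(x, T^n x) > 0] when [x <> alpha]: the values tend to
    [d(alpha, x) > 0], and none is 0, since a periodic convergent orbit is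
    constant ([orbit_separated]). *)

(** * Distances and limits *)

Lemma mdist_le_eq (R : realType) (X : metricType R) (x y : X) :
  (forall e, 0 < e -> mdist x y <= e) -> x = y.
Proof.
move=> small; apply/eqP/negP => /negP.
rewrite -mdist_gt0 => xy0.
by have := small _ (divr_gt0 xy0 (ltr0Sn R 1)); lra.
Qed.

Lemma cvg_mdistP (R : realType) (X : metricType R) (u : nat -> X) (a : X) :
  u n @[n --> \oo] --> a <->
  forall e, 0 < e -> exists m, forall n, (m <= n)%N -> mdist a (u n) < e.
Proof.
rewrite metricType_numDomainType.cvgrPdist_lt.
by split=> ua e /ua[m]; exists m.
Qed.

Lemma geometric_lt (R : realType) (k c e : R) :
  0 <= k < 1 -> 0 < e -> exists j, k ^+ j * c < e.
Proof.
move=> /andP[k0 k1] e0.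
have gcvg : geometric c k n @[n --> \oo] --> (0 : R).
  by apply: cvg_geometric; rewrite ger0_norm.
have [j _ jP] := cvgr0_norm_lt _ gcvg _ e0.
exists j; rewrite mulrC; exact: le_lt_trans (ler_norm _) (jP _ (leqnn j)).
Qed.

(** A periodic orbit passes infinitely often through its starting point, which
    is then its only possible limit. *)
Lemma periodic_cvg_eq (R : realType) (X : metricType R) (T : X -> X) (x a : X)
    (N : nat) : (0 < N)%N -> iter N T x = x ->
  iter n T x @[n --> \oo] --> a -> x = a.
Proof.
move=> N0 xN /cvg_mdistP xa; apply: mdist_le_eq => e /xa[m mP].
have /mP : (m <= m * N)%N by rewrite leq_pmulr.
by rewrite iterM iter_fix// metric_sym => /ltW.
Qed.

(** * Orbits of a universal iterative contraction *)

Lemma contraction_orbit_bounded (R : realType) (X : metricType R) (k : R)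
    (T : X -> X) (x : X) : universal_iterative_contraction k T ->
  exists M, forall n, mdist x (iter n T x) <= M.
Proof.
case=> /andP[k0 k1] _ /(_ x)[N [N0 NP]].
pose B : R := \sum_(i < N.+1) mdist x (iter i T x).
have B0 : 0 <= B by apply: sumr_ge0 => i _; exact: mdist_ge0.
have leB n : (n <= N)%N -> mdist x (iter n T x) <= B.
  rewrite -ltnS => nN; rewrite /B (bigD1 (Ordinal nN))//= lerDl.
  by apply: sumr_ge0 => i _; exact: mdist_ge0.
(* [M] solves [M = B + k M], which makes the bound stable under the step from
   [n] to [N + n]. *)
pose M := B / (1 - k).
have ME : B + k * M = M by rewrite /M; field; lra.
have M0 : 0 <= M by rewrite divr_ge0//; lra.
have BM : B <= M by rewrite -ME lerDl mulr_ge0.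
exists M; elim/ltn_ind => n IH.
have [/leB/le_trans|Nn] := leqP n N; first exact.
rewrite -ME (le_trans (metric_triangle _ (iter N T x) _))// lerD ?leB//.
have nN0 : (0 < n - N)%N by rewrite subn_gt0.
have := NP _ nN0; rewrite subnKC ?(ltnW Nn)// => /le_trans; apply.
by rewrite ler_wpM2l// IH// ltn_subrL N0 (leq_ltn_trans _ Nn).
Qed.

Lemma contraction_orbit_shrinks (R : realType) (X : metricType R) (k M : R)
    (T : X -> X) (x : X) : universal_iterative_contraction k T ->
    (forall n, mdist x (iter n T x) <= M) ->
  forall j, exists m, forall n,
    mdist (iter m T x) (iter (n + m) T x) <= k ^+ j * M.
Proof.
case=> /andP[k0 k1] _ contr xM; elim=> [|j [m mP]].
  by exists 0; move=> n; rewrite expr0 mul1r addn0.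
have [N [N0 NP]] := contr (iter m T x).
exists (N + m)%N => -[|n].
  by rewrite mdistxx mulr_ge0 ?exprn_ge0// (le_trans (mdist_ge0 _ _) (xM 0)).
rewrite addnA (addnC _ N) (iterD N) (iterD (N + _)).
apply: (le_trans (NP _ (ltn0Sn n))).
by rewrite exprS -mulrA ler_wpM2l// -iterD mP.
Qed.

Lemma contraction_orbit_cvg (R : realType) (X : completeMetricType R) (k : R)
    (T : X -> X) (x : X) : universal_iterative_contraction k T ->
  exists a : X, iter n T x @[n --> \oo] --> a.
Proof.
move=> contr; have [k01 _ _] := contr.
have [M xM] := contraction_orbit_bounded x contr.
suff /cauchy_cvg xcvg : cauchy (iter n T x @[n --> \oo]).
  by exists (lim (iter n T x @[n --> \oo])).
apply: cauchy_exP => e e0.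
have [j jP] := geometric_lt M k01 e0.
have [m mP] := contraction_orbit_shrinks contr xM j.
exists (iter m T x); exists m => // n /= mn.
by rewrite ballEmdist/= -(subnK mn) (le_lt_trans (mP _)).
Qed.

(** If two orbits ever meet, they coincide afterwards, and the contraction
    estimate holds trivially at all later times; so the distinctness required
    by the first condition is no obstacle to iterating it. *)
Lemma contraction_orbits_approach (R : realType) (X : metricType R) (k : R)
    (T : X -> X) (x y : X) : universal_iterative_contraction k T ->
  forall j, exists2 m, (j <= m)%N &
    mdist (iter m T x) (iter m T y) <= k ^+ j * mdist x y.
Proof.
case=> /andP[k0 k1] contr _; elim=> [|j [m jm mP]].
  by exists 0; rewrite // expr0 mul1r.
have [xy|/contr[N [N0 NP]]] := pselect (iter m T x = iter m T y).
  exists m.+1 => //.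
  by rewrite !iterS xy mdistxx mulr_ge0 ?exprn_ge0 ?mdist_ge0.
exists (N + m)%N; first by rewrite -add1n leq_add.
by rewrite !iterD (le_trans NP)// exprS -mulrA ler_wpM2l.
Qed.

Lemma contraction_limit_unique (R : realType) (X : metricType R) (k : R)
    (T : X -> X) (x y a b : X) : universal_iterative_contraction k T ->
  iter n T x @[n --> \oo] --> a -> iter n T y @[n --> \oo] --> b -> a = b.
Proof.
move=> contr /cvg_mdistP xa /cvg_mdistP yb; apply: mdist_le_eq => e e0.
have e3 : 0 < e / 3%:R by rewrite divr_gt0.
have [k01 _ _] := contr; have [k0 k1] := andP k01.
have [p pP] := xa _ e3; have [q qP] := yb _ e3.
have [j jP] := geometric_lt (mdist x y) k01 e3.
(* The common time must be late for both limits and for the approach. *)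
have [m mge mP] := contraction_orbits_approach x y contr (j + (p + q)).
have pm : (p <= m)%N by apply: leq_trans mge; rewrite addnCA leq_addr.
have qm : (q <= m)%N by apply: leq_trans mge; rewrite addnA leq_addl.
have xym : mdist (iter m T x) (iter m T y) < e / 3%:R.
  apply: le_lt_trans jP; apply: (le_trans mP).
  rewrite ler_wpM2r ?mdist_ge0// exprD ler_piMr ?exprn_ge0//.
  by rewrite exprn_ile1 // ltW.
have := metric_triangle a (iter m T x) b.
have := metric_triangle (iter m T x) (iter m T y) b.
have := pP _ pm; have := qP _ qm; rewrite (metric_sym b).
by lra.
Qed.

(** Letting [n] tend to infinity in the second condition at [a] gives
    [d(T^N a, a) <= k d(a, a) = 0], so [a] is periodic; no continuity of [T] is
    involved.  The orbit of [T a] is periodic as well, and converges to [a]. *)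
Lemma contraction_limit_fixed (R : realType) (X : metricType R) (k : R)
    (T : X -> X) (a : X) : universal_iterative_contraction k T ->
  (forall x, iter n T x @[n --> \oo] --> a) -> T a = a.
Proof.
case=> /andP[k0 k1] _ /(_ a)[N [N0 NP]] Ta.
have aN : iter N T a = a.
  apply: mdist_le_eq => e e0; have /cvg_mdistP aa := Ta a.
  have [m mP] := aa _ (divr_gt0 e0 (ltr0Sn R 1)).
  have mP1 := mP _ (leqnSn m).
  have mPN := mP _ (leq_trans (leqnSn m) (leq_addl N _)).
  have := NP _ (ltn0Sn m).
  have : k * mdist a (iter m.+1 T a) <= mdist a (iter m.+1 T a).
    by rewrite ler_piMl ?mdist_ge0 ?ltW.
  have := metric_triangle (iter N T a) (iter (N + m.+1) T a) a.
  by rewrite (metric_sym (iter (N + m.+1) T a)); lra.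
by apply: (periodic_cvg_eq N0) (Ta (T a)); rewrite -iterSr iterS aN.
Qed.

(** * Maps whose orbits all converge to one fixed point *)

(** The distances [d(x, T^n x)] are at least [d(a, x) / 2] for large [n], and
    the finitely many others are positive because [x] is not periodic. *)
Lemma orbit_separated (R : realType) (X : metricType R) (T : X -> X)
    (x a : X) : x <> a -> iter n T x @[n --> \oo] --> a ->
  exists2 d, 0 < d & forall n, (0 < n)%N -> d <= mdist x (iter n T x).
Proof.
move=> xNa xa.
have ret n : (0 < n)%N -> 0 < mdist x (iter n T x).
  move=> n0; rewrite mdist_gt0; apply/eqP => /esym xn.
  exact/xNa/(periodic_cvg_eq n0 xn xa).
have ax : 0 < mdist a x / 2%:R.
  by rewrite divr_gt0// mdist_gt0; apply/eqP/nesym.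
have [m mP] := (cvg_mdistP _ _).1 xa _ ax.
suff [d d0 dP] : exists2 d, 0 < d &
    forall n, (0 < n)%N -> (n < m)%N -> d <= mdist x (iter n T x).
  exists (Num.min d (mdist a x / 2%:R)); first by rewrite lt_min d0.
  move=> n n0; rewrite ge_min; have [mn|nm] := leqP m n; last by rewrite dP.
  apply/orP; right; have := mP _ mn; have := metric_triangle a (iter n T x) x.
  by rewrite (metric_sym x); lra.
elim: {mP} m => [|m [d d0 dP]]; first by exists 1.
case: m dP => [|m] dP; first by exists 1 => // -[].
exists (Num.min d (mdist x (iter m.+1 T x))); first by rewrite lt_min d0 ret.
move=> n n0; rewrite ltnS leq_eqVlt => /predU1P[->|nm].
  by rewrite ge_min lexx orbT.
by rewrite ge_min dP.
Qed.

Lemma cvg_orbits_contraction (R : realType) (X : metricType R) (k : R)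
    (T : X -> X) (a : X) : 0 < k < 1 -> T a = a ->
  (forall x, iter n T x @[n --> \oo] --> a) ->
  universal_iterative_contraction k T.
Proof.
move=> /andP[k0 k1] Taa Ta.
split=> [|x y /eqP|x]; first by rewrite ltW.
  rewrite -mdist_gt0 => xy0.
  have e0 : 0 < k * mdist x y / 2%:R by rewrite divr_gt0// mulr_gt0.
  have [p pP] := (cvg_mdistP _ _).1 (Ta x) _ e0.
  have [q qP] := (cvg_mdistP _ _).1 (Ta y) _ e0.
  exists (p + q).+1; split=> //.
  have := pP _ (leqW (leq_addr q p)); have := qP _ (leqW (leq_addl p q)).
  have := metric_triangle (iter (p + q).+1 T x) a (iter (p + q).+1 T y).
  by rewrite (metric_sym _ a); lra.
have [->|xa] := pselect (x = a).
  exists 1; split=> // n n0.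
  by rewrite !(iter_fix _ Taa) mdistxx mulr0.
have [d d0 dP] := orbit_separated xa (Ta x).
have e0 : 0 < k * d / 2%:R by rewrite divr_gt0// mulr_gt0.
have [m mP] := (cvg_mdistP _ _).1 (Ta x) _ e0.
exists m.+1; split=> // n n0.
apply: le_trans (_ : k * d <= _); last by rewrite ler_pM2l// dP.
have := mP _ (leqnSn m); have := mP _ (leq_trans (leqnSn m) (leq_addr n _)).
have := metric_triangle (iter m.+1 T x) a (iter (m.+1 + n) T x).
by rewrite (metric_sym _ a); lra.
Qed.

Theorem theorem5 (R : realType) (X : completeMetricType R) (k : R)
    (hk : 0 < k < 1) (T : X -> X) :
  universal_iterative_contraction k T <->
  exists alpha : X,
    [/\ T alpha = alpha,
        forall beta : X, T beta = beta -> beta = alpha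
      & forall x : X, iter n T x @[n --> \oo] --> alpha].
Proof.
split=> [contr|[a [Taa _ Ta]]]; last exact: cvg_orbits_contraction hk Taa Ta.
have [a pa] := contraction_orbit_cvg (point : X) contr.
have Ta x : iter n T x @[n --> \oo] --> a.
  have [b xb] := contraction_orbit_cvg x contr.
  by rewrite (contraction_limit_unique contr pa xb).
exists a; split=> [|b Tbb|//]; first exact: contraction_limit_fixed contr Ta.
(* A fixed point is periodic with period 1. *)
exact: (@periodic_cvg_eq _ _ T b a 1 _ Tbb (Ta b)).
Qed.
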